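(* Suppose that $\lambda$ is an infinite cardinal satisfying $2^{<\lambda}=\lambda$. Then $\circledast(\mathrm{cf}(2^\lambda),\omega)$ holds.
   Context: For an infinite cardinal $\kappa$ and a cardinal $\theta\le\kappa$, $\circledast(\kappa,\theta)$ asserts the existence of a colouring $d:[\kappa]^{<\omega}\rightarrow\theta$ such that for every $\kappa$-sized family $\mathcal X\subseteq[\kappa]^{<\omega}$ and every $\delta<\theta$, there exist two distinct $x,y\in\mathcal X$ such that $d(z)=\delta$ whenever $(x\mathbin\bigtriangleup y)\subseteq z\subseteq (x\cup y)$. Here $\mathrm{cf}$ denotes cofinality. *)

(* Defs.v *)
From mathcomp Require Import all_boot.
From mathcomp Require Import finmap.
From mathcomp Require Import boolp classical_sets functions cardinality wochoice.

Set Implicit Arguments.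
Unset Strict Implicit.
Unset Printing Implicit Defensive.

Local Open Scope classical_set_scope.
Local Open Scope card_scope.
Local Open Scope fset_scope.

(** The cardinal |T| is represented by the type T itself, and cardinals are
    compared with the library's [#<=] and [#=] on full sets. *)

Definition card_lt T U (A : set T) (B : set U) : Prop := ~ (B #<= A).

(** [is_pow2_lt L N]: |N| = 2^{<|L|}, the supremum of the cardinals 2^mu for
    mu < |L|. Every cardinal mu < |L| is the cardinal of some [M : set L]. *)
Definition is_pow2_lt (L N : Type) : Prop :=
  (forall M : set L, card_lt M [set: L] -> [set: M -> bool] #<= [set: N]) /\
  (forall P : Type,
    (forall M : set L, card_lt M [set: L] -> [set: M -> bool] #<= [set: P]) ->
    [set: N] #<= [set: P]).

(** [R] orders [T] in the order type of the initial ordinal |T|. [R] is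
    reflexive, so [~~ R x y] says that [y] is strictly below [x]. *)
Definition initial_well_order (T : Type) (R : rel T) : Prop :=
  well_order R /\ forall x : T, card_lt [set y | ~~ R x y] [set: T].

Definition cofinal_set (T : Type) (R : rel T) (A : set T) : Prop :=
  forall x : T, exists2 y, A y & R x y.

(** [is_cf T K]: |K| = cf(|T|), the least cardinal of a cofinal subset of the
    initial ordinal |T|. Any two initial well-orders of [T] are isomorphic, so
    the choice of [R] is immaterial. *)
Definition is_cf (T K : Type) : Prop :=
  exists2 R : rel T, initial_well_order R &
    (exists2 A : set T, cofinal_set R A & A #= [set: K]) /\
    (forall A : set T, cofinal_set R A -> [set: K] #<= A).

Definition symdiff (K : choiceType) (x y : {fset K}) : {fset K} :=
  (x `\` y) `|` (y `\` x).

(** The principle for kappa = |K| and theta = |T|. *)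
Definition circledast (K : choiceType) (T : Type) : Prop :=
  exists d : {fset K} -> T,
    forall X : set {fset K}, X #= [set: K] ->
    forall delta : T,
    exists x y : {fset K},
      [/\ X x, X y, x <> y &
        forall z : {fset K},
          symdiff x y `<=` z -> z `<=` x `|` y -> d z = delta].

(* Main.v *)
Require Import Defs.
From mathcomp Require Import all_boot.
From mathcomp Require Import finmap.
From mathcomp Require Import boolp classical_sets functions cardinality wochoice.

(** Write P = 2^lambda for the reals and kappa for cf(P). Since 2^{<lambda} =
    lambda, every level of the tree 2^{<lambda} can be coded by elements of
    lambda, so closed subsets of finite powers of P have only |P| many codes;
    split the set of codes into an increasing kappa-chain of pieces of size
    < |P|. Recursively choose reals e(a, m), for (a, m) in kappa x omega ordered
    lexicographically, so that e(a, m) is not one of the < |P| many values,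
    at tuples of earlier reals, of a selector of a closed set coded before
    stage a. As in Todorcevic's construction of an entangled set of size
    cf(2^lambda), every unbounded family of finite tuples then contains two
    tuples realising any prescribed pattern of lexicographic comparisons:
    above the tuple without its last entry, the closure of the family has at
    least two points, so that the last coordinate can be moved either way.

    Let the pair {a, b} have colour n if a and b compare the same way in
    coordinates 0, ..., n of e, and the opposite way in coordinate n + 1. Given
    a large family of finite sets, thin it out to have a root r and to make the
    tuples e(-, 0) of its members indistinguishable up to a level xi that
    separates each single member. For two such members x, y the only pairs in
    x `|` y that agree up to xi consist of corresponding elements of x \ r
    and y \ r. A finite set is therefore coloured n when, for some level, all
    its pairs that agree up to that level have colour n, and there is one. *)

Set Implicit Arguments.
Unset Strict Implicit.
Unset Printing Implicit Defensive.

Local Open Scope classical_set_scope.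
Local Open Scope card_scope.

(** * Cardinal arithmetic *)

(** A set is coerced to its subtype, so by [card_leE] this one relation serves for types and sets
    alike. *)
Definition embeds (T U : Type) : Prop := exists f : T -> U, injective f.

Lemma embeds_refl T : embeds T T.
Proof. by exists id. Qed.

Lemma embeds_trans T U V : embeds T U -> embeds U V -> embeds T V.
Proof. by move=> [f fI] [g gI]; exists (g \o f); apply: inj_comp. Qed.

Lemma card_leE T U (A : set T) (B : set U) : (A #<= B) <-> embeds A B.
Proof.
split=> [/card_leP[f]|[f fI]]; first by exists f; apply: in2TT; apply: inj.
by apply/card_leP/injfunPex; exists f; [move|apply: in2W].
Qed.

Definition set_elt T (A : set T) x (Ax : A x) : A := exist _ x (mem_set Ax).

Lemma embeds_val T (A : set T) : embeds A T.
Proof. by exists val; apply: val_inj. Qed.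

Lemma embeds_setT T : embeds T [set: T].
Proof.
have h (x : T) : x \in [set: T] by rewrite inE.
by exists (fun x => exist _ x (h x)) => x y [].
Qed.

Lemma card_le_setT T U : ([set: T] #<= [set: U]) <-> embeds T U.
Proof.
rewrite card_leE; split=> h.
  by apply: embeds_trans (embeds_setT T) (embeds_trans h (embeds_val _)).
by apply: embeds_trans (embeds_val _) (embeds_trans h (embeds_setT U)).
Qed.

(** Lets an injection be described by its graph, which avoids defining functions into subtypes. *)
Lemma embeds_rel T U (G : T -> U -> Prop) : (forall t, exists u, G t u) ->
  (forall t t' u, G t u -> G t' u -> t = t') -> embeds T U.
Proof.
by move=> /choice[f fG] Ginj; exists f => t t' e; apply: Ginj (fG t) _; rewrite e.
Qed.

(** By Zorn's lemma there is a maximal partial injection; if it missed a point on both sides, that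
    pair could be added. *)
Lemma embeds_total T U : embeds T U \/ embeds U T.
Proof.
pose P (G : set (T * U)) :=
  (forall t u u', G (t, u) -> G (t, u') -> u = u') /\
  (forall t t' u, G (t, u) -> G (t', u) -> t = t').
have [|G [[Gf Gi] Gmax]] := @Zorn_bigcup _ P.
  move=> F FP Ftot; split.
    move=> t u u' [A FA At] [B FB Bt]; have [Af _] := FP _ FA; have [Bf _] := FP _ FB.
    by case: (Ftot _ _ FA FB) => AB; [apply: (Bf t) => //; apply: AB|
                                       apply: (Af t) => //; apply: AB].
  move=> t t' u [A FA At] [B FB Bt]; have [_ Ai] := FP _ FA; have [_ Bi] := FP _ FB.
  by case: (Ftot _ _ FA FB) => AB; [apply: (Bi _ _ u) => //; apply: AB|
                                     apply: (Ai _ _ u) => //; apply: AB].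
have [Gt|/existsNP[t Nt]] := pselect (forall t, exists u, G (t, u)).
  by left; apply: embeds_rel Gt Gi.
have [Gu|/existsNP[u Nu]] := pselect (forall u, exists t, G (t, u)).
  by right; apply: (embeds_rel (G := fun u t => G (t, u))) Gu _ => u u' x; apply: Gf.
exfalso; apply: (Gmax (G `|` [set (t, u)])).
  split; first by left.
  by move=> /(_ (t, u)) h; apply: Nt; exists u; apply: h; right.
split.
  move=> a b b' [h|[-> ->]] [h'|[]]; first exact: Gf h h'.
  - by move=> ea _; case: Nt; exists b; rewrite -ea.
  - by case: Nt; exists b'.
  - by move=> ->.
move=> a b b' [h|[-> ->]] [h'|[]]; first exact: Gi h h'.
- by move=> _ eu; case: Nu; exists a; rewrite -eu.
- by case: Nu; exists b.
- by move=> ->.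
Qed.

Lemma embeds_prod T T' U U' : embeds T T' -> embeds U U' -> embeds (T * U) (T' * U').
Proof.
move=> [f fI] [g gI]; exists (fun p => (f p.1, g p.2)).
by move=> [a b] [c d] [/fI /= -> /gI /= ->].
Qed.

Lemma embeds_fun T U : embeds T U -> embeds (T -> bool) (U -> bool).
Proof.
move=> [f fI]; exists (fun (A : T -> bool) u => `[< exists2 t, A t & f t = u >]).
move=> A B AB; apply/funext => t; have := congr1 (fun h => h (f t)) AB.
have h (C : T -> bool) : `[< exists2 t', C t' & f t' = f t >] = C t.
  by apply/asboolP/idP => [[t' ? /fI <-]|]//; exists t.
by rewrite /= !h.
Qed.

Lemma Cantor T : ~ embeds (T -> bool) T.
Proof.
move=> [f fI]; pose A t := `[< forall B, f B = t -> ~~ B t >].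
have : A (f A) = ~~ A (f A); last by case: (A _).
apply/asboolP/idP => [h|nA B /fI->//].
exact: h.
Qed.

(* Zorn's lemma applied to the injections A * A -> A with A empty or containing
   a fixed countable set; [D G] is A, recovered from the graph [G]. *)
Lemma embeds_square T : embeds nat T -> embeds (T * T) T.
Proof.
move=> [f0 f0I].
pose D (G : set ((T * T) * T)) x := exists c, G ((x, x), c).
pose P G := [/\ forall p c d, G (p, c) -> G (p, d) -> c = d,
  forall p q c, G (p, c) -> G (q, c) -> p = q,
  forall x y, (exists c, G ((x, y), c)) <-> D G x /\ D G y,
  forall p c, G (p, c) -> D G c &
  G = set0 \/ forall n, D G (f0 n)].
have [pr prI] : embeds (nat * nat) nat.
  by have /card_eqPle[/card_le_setT ? _] := card_nat2.
pose G0 : set ((T * T) * T) :=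
  [set t | exists n m, t = ((f0 n, f0 m), f0 (pr (n, m)))].
have DG0 n : D G0 (f0 n) by exists (f0 (pr (n, n))), n, n.
have D0 x : D G0 x -> exists n, x = f0 n by move=> [c [n [m [-> _ _]]]]; exists n.
have PG0 : P G0.
  split.
  - by move=> p c d [n [m [-> ->]]] [n' [m' [/f0I-> /f0I-> ->]]].
  - by move=> p q c [n [m [-> ->]]] [n' [m' [-> /f0I/prI[-> ->]]]].
  - move=> x y; split=> [[c [n [m [-> -> _]]]]//|[/D0[n ->] /D0[m ->]]].
    by exists (f0 (pr (n, m))), n, m.
  - by move=> p c [n [m [_ ->]]].
  - by right.
have [|G [[Gf Gi Gd Gr G0'] Gmax]] := @Zorn_bigcup _ P.
  move=> F FP Ftot.
  have up A B : F A -> F B -> exists C, [/\ F C, A `<=` C & B `<=` C].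
    by move=> FA FB; case: (Ftot _ _ FA FB) => AB; [exists B|exists A]; split.
  split.
  - move=> p c d [A FA Ac] [B FB Bc]; have [C [/FP[Cf _ _ _ _] AC BC]] := up _ _ FA FB.
    by apply: Cf (AC _ Ac) (BC _ Bc).
  - move=> p c d [A FA Ac] [B FB Bc]; have [C [/FP[_ Ci _ _ _] AC BC]] := up _ _ FA FB.
    by apply: Ci (AC _ Ac) (BC _ Bc).
  - move=> x y; split=> [[c [A FA Ac]]|[[c [A FA Ac]] [d [B FB Bd]]]].
      have [_ _ Ad _ _] := FP _ FA.
      have [] := (Ad x y).1 (ex_intro _ c Ac).
      by move=> [a ?] [b ?]; split; [exists a|exists b]; exists A.
    have [C [FC AC BC]] := up _ _ FA FB; have [_ _ Cd _ _] := FP _ FC.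
    have [|e Ce] := (Cd x y).2; last by exists e, C.
    by split; [exists c; apply: AC|exists d; apply: BC].
  - move=> p c [A FA Ac]; have [_ _ _ Ar _] := FP _ FA.
    by have [d Ad] := Ar _ _ Ac; exists d, A.
  - have [e|/existsNP[A /not_implyP[FA A0]]] := pselect (forall A, F A -> A = set0).
      left; apply/seteqP; split=> // t [A FA]; by rewrite (e _ FA).
    have [_ _ _ _ [/A0//|H]] := FP _ FA; right => n.
    by have [c ?] := H n; exists c, A.
(* The empty graph is not maximal, since [G0] extends it. *)
have {}G0' n : D G (f0 n).
  case: G0' => // e; exfalso; apply: (Gmax _ _ PG0); rewrite e; split=> //.
  move=> /(_ ((f0 0, f0 0), f0 (pr (0, 0)))).
  by apply; exists 0, 0.
pose A : set T := D G.
have leA : embeds (A * A) A.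
  apply: (@embeds_rel _ _ (fun p c => G ((val p.1, val p.2), val c))).
    move=> [[a /set_mem ha] [b /set_mem hb]] /=.
    have [c Gc] := (Gd a b).2 (conj ha hb).
    by exists (exist _ c (mem_set (Gr _ _ Gc))).
  move=> [a b] [a' b'] c h h'; have /= [/val_inj-> /val_inj->//] := Gi _ _ _ h h'.
have leBA : embeds (bool * A) A.
  apply: embeds_trans leA; apply: embeds_prod (embeds_refl _).
  exists (fun b : bool => set_elt (G0' b)).
  by move=> [] [] // [/f0I].
(* If the complement of A embeds into A, then T embeds into two copies of A, hence into A. *)
case: (embeds_total A (~` A)) => [[g gI]|leC]; last first.
  have leTA : embeds T A.
    case: leC => g gI; apply: embeds_trans leBA.
    exists (fun x => match pselect (A x) with
      | left h => (true, set_elt h)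
      | right h => (false, g (@set_elt _ (~` A) _ h)) end).
    by move=> x y; case: pselect => a; case: pselect => b // [] // /gI [].
  by apply: embeds_trans (embeds_prod leTA leTA) (embeds_trans leA (embeds_val _)).
(* Otherwise the complement contains a copy B of A, and sending the new pairs of A [|] B into B
   extends the maximal graph. *)
exfalso.
pose B : set T := [set val (g a) | a in [set: A]].
have BA x : B x -> ~ A x by move=> [a _ <-]; apply: set_valP (g a).
pose C := A `|` B.
have leCC : embeds (C * C) A.
  have leCA : embeds C (bool * A).
    apply: (@embeds_rel _ _ (fun c p => val c = if p.1 then val p.2 else val (g p.2))).
      move=> [x /set_mem /= [h|[a _ <-]]]; last by exists (false, a).
      by exists (true, set_elt h).
    by move=> x y p e e'; apply: val_inj; rewrite e e'.
  by apply: embeds_trans (embeds_prod leCA leCA) (embeds_trans (embeds_prod leBA leBA) leA).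
case: leCC => h hI.
pose H : set ((T * T) * T) := [set t | exists x y : C,
  [/\ t = ((val x, val y), val (g (h (x, y)))) & ~ (A (val x) /\ A (val y))]].
have DA x : A x -> D (G `|` H) x by move=> [c]; exists c; left.
have DB x : B x -> D (G `|` H) x.
  move=> Bx; pose x' : C := set_elt (or_intror Bx).
  by exists (val (g (h (x', x')))); right; exists x', x'; split=> // -[/(BA _ Bx)].
have DC x : D (G `|` H) x <-> C x.
  split=> [[c [Gc|[y [z [[-> _ _] _]]]]]|[/DA|/DB]//]; first by left; exists c.
  exact: set_valP.
apply: (Gmax (G `|` H)).
  split; first by left.
  pose a0 : A := set_elt (G0' 0).
  have Bg : B (val (g a0)) by exists a0.
  by move=> s; apply: (BA _ Bg); have [c /s] := DB _ Bg; exists c.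
split.
- move=> p c d [Gc|[x [y [[-> ->] n]]]] [Gc'|[x' [y' [[]]]]].
  + exact: Gf Gc Gc'.
  + by move=> ep _ []; apply/Gd; exists c; rewrite -ep.
  + by case: n; apply/Gd; exists d.
  + by move=> /val_inj -> /val_inj -> -> _.
- move=> p q c [Gc|[x [y [[-> ->] n]]]] [Gc'|[x' [y' []]]].
  + exact: Gi Gc Gc'.
  + move=> [_ ec] _; have := Gr _ _ Gc; rewrite ec => Ac.
    by have := set_valP (g (h (x', y'))).
  + by have := set_valP (g (h (x, y))); case; exact: Gr Gc'.
  + by move=> [-> /val_inj/gI/hI[-> ->]].
- move=> x y; rewrite !DC; split.
    move=> [c [Gc|[x' [y' [[-> -> _] _]]]]]; last by split; apply: set_valP.
    by have [? ?] := (Gd x y).1 (ex_intro _ c Gc); split; left.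
  move=> [Cx Cy]; have [hA|n] := pselect (A x /\ A y).
    by have [c ?] := (Gd x y).2 hA; exists c; left.
  pose x' : C := set_elt Cx; pose y' : C := set_elt Cy.
  by exists (val (g (h (x', y')))); right; exists x', y'.
- move=> p c; rewrite DC => -[/Gr|[x [y [[_ ->] _]]]]; first by left.
  by right; exists (h (x, y)).
- by right => n; apply: DA; exact: G0'.
Qed.

(** Iterated pairing is injective on lists of a given length, so the length is made part of the
    code. *)
Lemma embeds_seq T : embeds nat T -> embeds (seq T) T.
Proof.
move=> leNT; have [p pI] := embeds_square leNT; case: leNT => f fI.
exists (fun s => p (f (size s), foldr (fun x a => p (x, a)) (f 0) s)).
move=> s t /pI[/fI]; elim: s t => [|x s IH] [|y t] //= [es] /pI[-> /(IH t es)->//].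
Qed.

Lemma embeds_seq_map T U : embeds T U -> embeds (seq T) (seq U).
Proof. by move=> [f fI]; exists (map f); apply: inj_map. Qed.

Lemma embeds_option T : embeds nat T -> embeds (option T) T.
Proof.
move=> leNT; apply: embeds_trans (embeds_square leNT); case: leNT => f fI.
exists (fun o => if o is Some t then (f 1, t) else (f 0, f 0)).
by move=> [x|] [y|] // [] // => [->|/fI|/fI].
Qed.

(** An infinite T absorbs one more point, and the image of that point is free to replace [None]. *)
Lemma embeds_option_inv T A : embeds nat T -> embeds T (option A) -> embeds T A.
Proof.
move=> leNT leT; have [g gI] : embeds (option T) (option A).
  exact: embeds_trans (embeds_option leNT) leT.
case e0: (g None) => [a0|]; last first.
  apply: (embeds_rel (G := fun t a => g (Some t) = Some a)) => [t|t t' a <- /gI[]//].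
  by case e: (g _) => [a|]; [exists a|move: e; rewrite -e0 => /gI].
exists (fun t => odflt a0 (g (Some t))) => t t'.
case e: (g (Some t)) => [a|]; case e': (g (Some t')) => [a'|] //= h.
- by move: e; rewrite h -e' => /gI[].
- by move: e; rewrite h -e0 => /gI.
- by move: e'; rewrite -h -e0 => /gI.
- by move: e; rewrite -e' => /gI[].
Qed.

(** * Well-orders and cofinality *)

Section WellOrder.
Variables (T : Type) (R : rel T).
Hypothesis Rwo : well_order R.

Lemma wo_min (A : set T) x : A x -> exists2 z, A z & forall y, A y -> R z y.
Proof.
move=> Ax; have [|z [[Az zm] _]] := Rwo (A := fun y => `[< A y >]).
  by exists x; apply/asboolP.
by exists z => [|y Ay]; [apply/asboolP|apply: zm; apply/asboolP].
Qed.

Lemma wo_total x y : R x y || R y x.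
Proof.
have [z [->|->] h] := @wo_min [set z | z = x \/ z = y] x (or_introl erefl).
  by rewrite h //; right.
by rewrite (h x) ?orbT //; left.
Qed.

Lemma wo_refl x : R x x.
Proof. by have := wo_total x x; rewrite orbb. Qed.

(** Minima are unique by definition of [well_order], and x and y are both minima of their pair. *)
Lemma wo_anti x y : R x y -> R y x -> x = y.
Proof.
move=> xy yx; pose A : {pred T} := fun z => `[< z = x \/ z = y >].
have [|z [_ zu]] := Rwo (A := A); first by exists x; apply/asboolP; left.
have hm w : w = x \/ w = y -> minimum_of R A w.
  by move=> wE; split; [apply/asboolP|case: wE => -> v /asboolP[]->; rewrite ?wo_refl].
by rewrite -(zu x) ?(zu y) //; apply: hm; [right|left].
Qed.

Lemma wo_trans y x z : R x y -> R y z -> R x z.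
Proof.
move=> xy yz.
have [w h hm] := @wo_min [set w | [\/ w = x, w = y | w = z]] x (Or31 _ _ erefl).
have [wx wy wz] : [/\ R w x, R w y & R w z] by split; apply: hm; constructor.
case: h => e; first by rewrite -e.
  by rewrite (wo_anti xy) // -e.
by rewrite e in wy; rewrite -(wo_anti yz wy).
Qed.

Lemma woN x y : ~~ R x y -> R y x.
Proof. by case/orP: (wo_total x y) => // ->. Qed.

Lemma wo_wf : well_founded (fun x y => ~~ R y x).
Proof.
move=> x; apply: contrapT => nx.
have [z nz zm] := @wo_min [set x | ~ Acc (fun x y => ~~ R y x) x] x nx.
apply: nz; constructor => y yz; apply: contrapT => /zm zy.
by rewrite zy in yz.
Qed.

(** A closed segment is an open one plus a point, which makes no difference for infinite T. *)
Lemma seg_le : embeds nat T -> (forall x, ~ embeds T [set y | ~~ R x y]) ->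
  forall x, ~ embeds T [set y | R y x].
Proof.
move=> leNT Rini x leTx; apply: (Rini x); apply: embeds_option_inv leNT _.
apply: embeds_trans leTx _.
apply: (embeds_rel (G := fun y o => if o is Some z then val y = val z else val y = x)).
  move=> [y /set_mem /= yx]; have [xy|nxy] := boolP (R x y).
    by exists None; apply: wo_anti.
  by exists (Some (@set_elt _ [set y | ~~ R x y] _ nxy)).
by move=> t t' [a|] e e'; apply: val_inj; rewrite e e'.
Qed.

End WellOrder.

(* Transport a well-order of T along T ~ S, where S is its shortest initial
   segment of full size. *)
Lemma initial_exists T : exists R : rel T, well_order R /\
  forall x : T, ~ embeds T [set y | ~~ R x y].
Proof.
elim/Peq: T => T; have [R0 R0wo] := well_ordering_principle T.
have [h|/existsNP[x0 /contrapT h0]] := pselect (forall x : T, ~ embeds T [set y | ~~ R0 x y]).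
  by exists R0.
have [x [f fI] xm] := wo_min R0wo (A := [set x | embeds T [set y | ~~ R0 x y]]) h0.
exists (fun a b => R0 (val (f a)) (val (f b))); split.
  apply: antisymmetric_well_order => [a b /andP[h h']|A [a Aa]].
    by apply/fI/val_inj/(wo_anti R0wo).
  pose B := [set val (f a) | a in [set a | a \in A]].
  have [|_ [b Ab <-] zm] := wo_min R0wo (A := B) (x := val (f a)).
    by exists a.
  by exists b; split => // c Ac; apply: zm; exists c.
move=> a leTa; have : R0 x (val (f a)).
  apply: xm; apply: embeds_trans leTa _.
  apply: (embeds_rel (G := fun b y => val (f (val b)) = val y)).
    by move=> [b /set_mem /= ab]; exists (@set_elt _ [set y | ~~ R0 (val (f a)) y] _ ab).
  by move=> b b' y <- /val_inj/fI/val_inj->.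
by apply/negP; have /= := set_valP (f a).
Qed.

Lemma cofinal_enum P K (R : rel P) (A : set P) : cofinal_set R A -> embeds A K -> P ->
  exists g : K -> P, forall p, exists k, R p (g k).
Proof.
move=> Acof [j jI] p0.
have /choice[g gP] k : exists p : P, forall a, j a = k -> val a = p.
  have [[a e]|n] := pselect (exists a, j a = k).
    by exists (val a) => b; rewrite -e => /jI->.
  by exists p0 => a e; case: n; exists a.
by exists g => p; have [a Aa pa] := Acof p; exists (j (set_elt Aa)); rewrite -(gP _ (set_elt Aa)).
Qed.

(* Diagonalise against the initial segments below a cofinal lambda-sequence,
   after identifying 2^lambda with its lambda-th power. *)
Lemma konig L K : embeds nat L -> is_cf (L -> bool) K -> ~ embeds K L.
Proof.
move=> leNL [R [Rwo Rini] [[A Acof Acard] _]] leKL.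
have leNP : embeds nat (L -> bool).
  apply: embeds_trans leNL _; exists (fun x y => `[< x = y >]).
  by move=> x y /(congr1 (fun f => f y)) /asboolP; rewrite asboolT // => /asboolP.
have {}Rini := seg_le Rwo leNP
  (fun x h => Rini x ((card_leE _ _).2 (embeds_trans (embeds_val _) h))).
have leAL : embeds A L.
  move: Acard; rewrite card_eq_le => /andP[/card_leE h _].
  exact: embeds_trans h (embeds_trans (embeds_val _) leKL).
have [g gP] := cofinal_enum Acof leAL (fun=> true).
have [w wI] : embeds (L -> (L -> bool)) (L -> bool).
  apply: embeds_trans (embeds_fun (embeds_square leNL)).
  exists (fun f p => f p.1 p.2) => f f' e; apply/funext => x; apply/funext => y.
  exact: (congr1 (fun h : L * L -> bool => h (x, y)) e).
(* The functions coded at or below [g l] are fewer than 2^lambda, so their values at [l] miss some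
   p. *)
have /choice[f fP] l : exists p : L -> bool, ~ exists2 f, f l = p & R (w f) (g l).
  apply/existsNP => h; apply: (Rini (g l)).
  apply: (embeds_rel (G := fun p y => exists2 f, f l = p & w f = val y)).
    by move=> p; have [f fl wf] := h p; exists (@set_elt _ [set y | R y (g l)] _ wf), f.
  by move=> p p' y [f <- <-] [f' <- /wI->].
by have [l fl] := gP (w f); apply: (fP l); exists f.
Qed.

(** Collects all that is used about cf(2^lambda): it is regular, and 2^lambda is exhausted by an
    increasing chain of smaller sets of that length. *)
Lemma cf_regular L K : embeds nat L -> is_cf (L -> bool) K ->
  exists RK : rel K, [/\ well_order RK, forall k, ~ embeds K [set y | RK y k],
    forall B, cofinal_set RK B -> embeds K B, embeds K (L -> bool) &
    exists F : K -> set (L -> bool),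
      (forall p, exists k, forall k', RK k k' -> F k' p) /\
      forall k, ~ embeds (L -> bool) (F k)].
Proof.
move=> leNL Kcf; have nKL := konig leNL Kcf.
case: Kcf => R [Rwo Rini] [[A Acof Acard] Amin].
have leLK : embeds L K by case: (embeds_total K L).
have leNK : embeds nat K by exact: embeds_trans leNL leLK.
have leNP : embeds nat (L -> bool).
  apply: embeds_trans leNL _; exists (fun x y => `[< x = y >]).
  by move=> x y /(congr1 (fun f => f y)) /asboolP; rewrite asboolT // => /asboolP.
have {}Rini := seg_le Rwo leNP
  (fun x h => Rini x ((card_leE _ _).2 (embeds_trans (embeds_val _) h))).
have leAK : embeds A K.
  move: Acard; rewrite card_eq_le => /andP[/card_leE h _].
  exact: embeds_trans h (embeds_val _).
have {}Amin (B : set (L -> bool)) : cofinal_set R B -> embeds K B.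
  by move=> /Amin/card_leE; apply: embeds_trans; exact: embeds_setT.
have [g gP] := cofinal_enum Acof leAK (fun=> true).
have [RK [RKwo /(seg_le RKwo leNK) RKini]] := initial_exists K.
have leI (f : K -> L -> bool) (B : set K) : embeds (f @` B) B.
  by apply/card_leE; exact: card_image_le.
(* A segment of K has fewer than cf(2^lambda) points, so [g] is bounded on it. *)
have /choice[h hP] k : exists p, forall k', RK k' k -> R (g k') p.
  apply: contrapT => /forallNP n; apply: (RKini k).
  apply: embeds_trans (leI g _); apply: Amin => p.
  have /existsNP[k' /not_implyP[kk /negP np]] := n p.
  by exists (g k'); [exists k'|exact: woN].
exists RK; split=> // [B Bcof||].
  apply: embeds_trans (leI h B); apply: Amin => p.
  have [k pk] := gP p; have [b Bb kb] := Bcof k.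
  by exists (h b); [exists b|exact: (wo_trans Rwo pk (hP _ _ kb))].
  move: Acard; rewrite card_eq_le => /andP[_ /card_leE KA].
  exact: embeds_trans (embeds_setT K) (embeds_trans KA (embeds_val _)).
exists (fun k => [set p | R p (h k)]); split=> // p.
by have [k pk] := gP p; exists k => k' kk'; exact: (wo_trans Rwo pk (hP _ _ kk')).
Qed.

(** * Entangled families of reals *)

Lemma lt_sup P A B : ~ embeds P A -> ~ embeds P B -> ~ embeds P nat ->
  exists Z : Type, [/\ embeds nat Z, embeds A Z, embeds B Z & ~ embeds P Z].
Proof.
move=> nA nB nN; have [Z [nZ AZ BZ]] : exists Z : Type, [/\ ~ embeds P Z, embeds A Z & embeds B Z].
  by case: (embeds_total A B) => h; [exists B|exists A]; split=> //; exact: embeds_refl.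
case: (embeds_total nat Z) => h; first by exists Z.
by exists nat; split=> //; [exact: embeds_refl|exact: embeds_trans AZ h|exact: embeds_trans BZ h].
Qed.

(** The values found so far are completed by [p0] to a total function; this is harmless because Q
    only looks below i. *)
Lemma wf_recursion I P (lt : I -> I -> Prop) (Q : I -> (I -> P) -> P -> Prop) :
  well_founded lt -> P ->
  (forall i g, exists p, Q i g p) ->
  (forall i g g' p, (forall j, lt j i -> g j = g' j) -> Q i g p -> Q i g' p) ->
  exists e, forall i, Q i e (e i).
Proof.
move=> ltwf p0 Qex Qloc.
have /choice[G GQ] (t : I * (I -> P)) : exists p, Q t.1 t.2 p by exact: Qex.
pose H i (rec : forall j, lt j i -> P) :=
  G (i, fun j => match pselect (lt j i) with left h => rec j h | right _ => p0 end).
exists (Fix ltwf (fun=> P) H) => i; rewrite Fix_eq.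
  refine (Qloc _ _ _ _ _ (GQ (i, _))) => j ji /=.
  by case: pselect.
move=> j f g fg; congr (G (_, _)); apply/funext => x.
by case: pselect => // h; exact: fg.
Qed.

(** * Restrictions of reals to levels and lexicographic comparison *)

Section Levels.
Variables (L : Type) (RL : rel L).
Hypothesis RLwo : well_order RL.
Local Notation P := (L -> bool).

Definition agree (xi : L) (x y : P) := forall l, RL l xi -> x l = y l.

(** Here 2^{<lambda} = lambda enters: a closed segment is smaller than lambda, so it carries at most
    lambda restrictions. *)
Lemma level_code : is_pow2_lt L L -> (forall xi, ~ embeds L [set l | RL l xi]) ->
  exists c : L -> P -> L, forall xi x y, c xi x = c xi y <-> agree xi x y.
Proof.
move=> [pow _] small; suff /choice[c cP] xi : exists f : P -> L,
  forall x y, f x = f y <-> agree xi x y by exists c.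
have [|h hI] := (card_le_setT _ _).1 (pow [set l | RL l xi] _).
  by move=> /card_leE h; apply: (small xi); exact: embeds_trans (embeds_setT L) h.
exists (fun x => h (x \o val)) => x y; split=> [/hI e l lxi|xy].
  exact: (congr1 (fun f : [set l | RL l xi] -> bool => f (set_elt (A := [set l | RL l xi]) lxi)) e).
by congr h; apply/funext => -[l lxi]; apply: xy; have := set_mem lxi.
Qed.

(** Lexicographic order with the first difference at or below xi, so that it depends on restrictions
    to xi only. *)
Definition lexat (xi : L) (x y : P) :=
  exists2 l, RL l xi & [/\ forall m, ~~ RL l m -> x m = y m, x l = false & y l = true].

Lemma lexat_agree xi x x' y y' : agree xi x x' -> agree xi y y' ->
  lexat xi x y -> lexat xi x' y'.
Proof.
move=> xx yy [l lxi [h xl yl]]; exists l => //; split.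
- move=> m ml; have mxi : RL m xi by exact: wo_trans RLwo _ _ _ (woN RLwo ml) lxi.
  by rewrite -xx // -yy // h.
- by rewrite -xx.
- by rewrite -yy.
Qed.

Lemma lexat_mono xi xi' x y : RL xi xi' -> lexat xi x y -> lexat xi' x y.
Proof. by move=> xixi [l lxi h]; exists l => //; exact: wo_trans RLwo _ _ _ lxi xixi. Qed.

Lemma lex_total x y : x <> y -> exists xi, lexat xi x y \/ lexat xi y x.
Proof.
move=> xy; have [l0 nl0] : exists l, x l <> y l.
  by apply/existsNP => h; apply: xy; apply/funext.
have [l nl lm] := wo_min RLwo (A := [set l | x l <> y l]) nl0.
have h m : ~~ RL l m -> x m = y m by move=> /negP nm; apply: contrapT => /lm.
exists l; case ex: (x l); case ey: (y l); rewrite /= ex ey // in nl.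
  by right; exists l; [exact: wo_refl|split => // m /h].
by left; exists l; [exact: wo_refl|split].
Qed.

Lemma lex_asym xi xi' x y : lexat xi x y -> lexat xi' y x -> False.
Proof.
move=> [l _ [h xl yl]] [l' _ [h' yl' xl']].
have [ll|/h'] := boolP (RL l' l); last by rewrite xl yl.
have [ll'|/h] := boolP (RL l l'); last by rewrite xl' yl'.
by rewrite (wo_anti RLwo ll ll') xl in xl'.
Qed.

Fixpoint signs (xi : L) (ts : seq bool) (a b : seq P) : Prop :=
  match ts, a, b with
  | [::], [::], [::] => True
  | t :: ts, x :: a, y :: b =>
    (if t then lexat xi x y else lexat xi y x) /\ signs xi ts a b
  | _, _, _ => False
  end.

Lemma signs_mono xi xi' ts a b : RL xi xi' -> signs xi ts a b -> signs xi' ts a b.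
Proof.
move=> xx; elim: ts a b => [|t ts IH] [|x a] [|y b] //= [h /IH ?]; split=> //.
by case: t h => /(lexat_mono xx).
Qed.

Section Code.
Variable c : L -> P -> L.
Hypothesis cP : forall xi x y, c xi x = c xi y <-> agree xi x y.

Lemma signs_code xi ts a b a' b' : map (c xi) a = map (c xi) a' ->
  map (c xi) b = map (c xi) b' -> signs xi ts a b -> signs xi ts a' b'.
Proof.
elim: ts a b a' b' => [|t ts IH] [|x a] [|y b] // [|x' a'] [|y' b'] //=.
move=> [/cP xx ea] [/cP yy eb] [h /(IH _ _ _ _ ea eb) ?]; split=> //.
by case: t h; apply: lexat_agree.
Qed.

(* [C] lists levels [xi] together with codes of restrictions to [xi] of tuples
   of reals; [clos C u v] says that [v :: u] lies in the closed set coded by [C]. *)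
Definition clos (C : seq L -> bool) (u : seq P) (v : P) :=
  forall xi, C (xi :: c xi v :: map (c xi) u).

(** The selector sees only the code and the tail, so the recursion can avoid its values before the
    next real is chosen. *)
Lemma clos_select : exists f : (seq L -> bool) -> seq P -> P,
  forall C u v, clos C u v -> clos C u (f C u).
Proof.
have /choice[f fP] (t : (seq L -> bool) * seq P) : exists v,
    (exists v', clos t.1 t.2 v') -> clos t.1 t.2 v.
  have [[v h]|n] := pselect (exists v', clos t.1 t.2 v'); first by exists v.
  by exists (fun=> true) => h; case: n.
by exists (fun C u => f (C, u)) => C u v h; apply: (fP (C, u)); exists v.
Qed.

Section Generic.
Variables (K : choiceType) (RK : rel K).
Hypotheses (RKwo : well_order RK) (leNL : embeds nat L).
Hypothesis (RKini : forall k, ~ embeds K [set y | RK y k]).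
Hypotheses (RKcof : forall B, cofinal_set RK B -> embeds K B).
Hypotheses (leKP : embeds K P) (nKL : ~ embeds K L).
Variable F : K -> set P.
Hypothesis FP : forall p, exists k, forall k', RK k k' -> F k' p.
Hypothesis Fsmall : forall k, ~ embeds P (F k).

(** By regularity, the range of [g] is too small to be cofinal. *)
Lemma cf_bounded N (g : N -> K) : ~ embeds K N -> exists k, forall n, RK (g n) k.
Proof.
move=> nKN; apply: contrapT => /forallNP h; apply: nKN.
have leg : embeds (range g) N.
  apply: embeds_trans (embeds_val [set: N]); apply/card_leE; exact: card_image_le.
apply: embeds_trans leg; apply: RKcof => k.
have /existsNP[n /negP nk] := h k.
by exists (g n); [exists n|exact: woN].
Qed.

Definition ltI (j i : K * nat) : bool :=
  ~~ RK i.1 j.1 || (i.1 == j.1) && (j.2 < i.2).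

Lemma ltI_wf : well_founded ltI.
Proof.
move=> [k n]; elim/(well_founded_ind (wo_wf RKwo)): k n => k IHk n.
elim/ltn_ind: n => n IHn; constructor => -[k' n'] /orP[/IHk//|/andP[/eqP /= <-]].
exact: IHn.
Qed.

(** At each stage the forbidden values are indexed by a set smaller than 2^lambda: codes in [F i.1]
    paired with lists of earlier indices. *)
Lemma generic_family (w : (seq L -> bool) -> P) (f : (seq L -> bool) -> seq P -> P) :
  injective w -> exists e : K * nat -> P,
  (forall j i, ltI j i -> e i <> e j) /\
  (forall i C u, F i.1 (w C) -> all (ltI^~ i) u -> e i <> f C (map e u)).
Proof.
move=> wI.
pose Q i (g : K * nat -> P) p := (forall j, ltI j i -> p <> g j) /\
  (forall C u, F i.1 (w C) -> all (ltI^~ i) u -> p <> f C (map g u)).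
have [|i g|i g g' p gg [h h']|e eQ] := @wf_recursion (K * nat) P ltI Q ltI_wf.
- exact: (fun=> true).
- apply: contrapT => /forallNP nQ.
  pose B : set (K * nat) := [set j | ltI j i].
  have nPk : ~ embeds P [set k | RK k i.1].
    by move=> h; apply: (RKini (k := i.1)); exact: embeds_trans leKP h.
  have nPN : ~ embeds P nat by move=> h; apply: (@Cantor L); exact: embeds_trans h leNL.
  have [Z [NZ FZ kZ]] := lt_sup (Fsmall (k := i.1)) nPk nPN; apply.
  have ZZ := embeds_square NZ.
  have BZ : embeds B Z.
    apply: embeds_trans ZZ; apply: embeds_trans (embeds_prod kZ NZ).
    apply: (embeds_rel (G := fun j t => (val j).1 = val t.1 /\ (val j).2 = t.2)).
      move=> [j /set_mem jB] /=.
      have jk : RK j.1 i.1.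
        by case/orP: jB => [/(woN RKwo)//|/andP[/eqP-> _]]; exact: wo_refl.
      by exists (@set_elt _ [set k | RK k i.1] _ jk, j.2).
    move=> j j' t [h1 h2] [h1' h2']; apply: val_inj.
    by rewrite (surjective_pairing (val j)) h1 h2 -h1' -h2' -surjective_pairing.
  have leO : embeds (option (F i.1)) Z.
    apply: embeds_trans (embeds_option NZ); case: FZ => q qI; exists (omap q).
    by move=> [x|] [y|] //= [/qI->].
  have leS : embeds (seq B) Z by exact: embeds_trans (embeds_seq_map BZ) (embeds_seq NZ).
  apply: embeds_trans ZZ; apply: embeds_trans (embeds_prod leO leS).
  (* A pair with [Some] names a selector value, one with [None] an earlier real. *)
  pose G p (t : option (F i.1) * seq B) := match t with
    | (Some x, u) => exists2 C, val x = w C & p = f C (map (g \o val) u)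
    | (None, j :: _) => p = g (val j)
    | _ => False end.
  apply: (embeds_rel (G := G)); last first.
    move=> p p' [[x|] [|j u]] //=; try by move=> [C -> ->] [C' /wI -> ->].
    by move=> -> ->.
  move=> p; have /not_andP[/existsNP[j /not_implyP[ji /contrapT ->]]|] := nQ p.
    by exists (None, [:: set_elt (A := B) ji]).
  move=> /existsNP[C /existsNP[u /not_implyP[FC /not_implyP[ui /contrapT ->]]]].
  have [s <-] : exists s : seq B, map val s = u.
    elim: u ui => [|j u IH] /=; first by exists [::].
    by move=> /andP[ji /IH[s <-]]; exists (set_elt (A := B) ji :: s).
  by exists (Some (set_elt FC), s), C => //; rewrite -map_comp.
- split=> [j ji|C u FC ui]; first by rewrite -gg //; exact: h.
  have -> : map g' u = map g u; last exact: h'.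
  by apply/eq_in_map => j /(allP ui) ji; rewrite gg.
exists e; split=> [j i ji|i C u]; first by have [h _] := eQ i; apply: h.
by have [_ h] := eQ i; apply: h.
Qed.

(* Tuples are decreasing, so the head of [b] is the entry to be avoided. For all
   but boundedly many [i :: u] in [Y], both [e i] and the selected value lie in the
   fibre over [u] of the closure [C] of [Y] and are distinct; the pigeonhole
   principle fixes codes of two such points, and the induction hypothesis
   applies to the tails [u]. *)
Lemma entangled (w : (seq L -> bool) -> P) (f : (seq L -> bool) -> seq P -> P)
    (e : K * nat -> P) (k0 : K) :
  (forall C u v, clos C u v -> clos C u (f C u)) ->
  (forall i C u, F i.1 (w C) -> all (ltI^~ i) u -> e i <> f C (map e u)) ->
  forall (ts : seq bool) (Y : set (seq (K * nat))),
  (forall b, Y b -> size b = size ts /\ pairwise (fun i j => ltI j i) b) ->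
  (forall k, exists2 b, Y b & all (fun i => RK k i.1) b) ->
  exists xi b b', [/\ Y b, Y b' & signs xi ts (map e b) (map e b')].
Proof.
move=> fP eP; elim=> [|s ts IH] Y Yb Yunb.
  have [b Y_b _] := Yunb k0; have [/size0nil eb _] := Yb _ Y_b.
  by have [n _] := leNL; exists (n 0), b, b; split=> //; rewrite eb.
pose C (x : seq L) := `[< exists xi b, Y b /\ x = xi :: map (c xi \o e) b >].
have [k1 k1P] := FP (w C).
have closP u v : clos C u v ->
    forall xi, exists2 b, Y b & map (c xi) (v :: u) = map (c xi) (map e b).
  move=> h xi; have /asboolP[_ [b [Y_b [<- e1]]]] := h xi.
  by exists b => //; rewrite -map_comp -e1.
(* The triple n holds a level separating two points of the fibre over u and their codes at that
   level. *)
pose D u (n : L * L * L) := exists v v', [/\ clos C (map e u) v,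
  clos C (map e u) v', lexat n.1.1 v v', c n.1.1 v = n.1.2 & c n.1.1 v' = n.2].
pose Y' n := [set u | (exists i, Y (i :: u)) /\ D u n].
have [n Yn] : exists n, forall k, exists2 u, Y' n u & all (fun i => RK k i.1) u.
  apply: contrapT => /forallNP h.
  have /choice[g gP] n : exists k, ~ exists2 u, Y' n u & all (fun i => RK k i.1) u.
    by apply/existsNP; exact: h.
  have [|k2 k2P] := cf_bounded g.
    (* There are only lambda many triples. *)
    move=> h'; apply: nKL; apply: embeds_trans h' _.
    apply: embeds_trans (embeds_square leNL).
    by apply: embeds_prod (embeds_refl _); exact: embeds_square.
  have [k [kk1 kk2]] : exists k, RK k1 k /\ RK k2 k.
    by case/orP: (wo_total RKwo k1 k2) => ?; [exists k2|exists k1]; rewrite wo_refl.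
  (* Beyond [k1] the real [e i] avoids the selector for C; beyond [k2] the tail u violates the bound
     [g n] for every n. *)
  have [[|i u] Yiu] := Yunb k; have [//= + +] := Yb _ Yiu.
  move=> _ /andP[ui _] /andP[ki ku].
  have cl1 : clos C (map e u) (e i).
    by move=> xi; apply/asboolP; exists xi, (i :: u); rewrite /= -map_comp.
  have cl2 := fP _ _ _ cl1.
  have [xi lx] : exists xi, lexat xi (e i) (f C (map e u)) \/ lexat xi (f C (map e u)) (e i).
    by apply: lex_total; apply: eP ui; apply: k1P; exact: wo_trans RKwo _ _ _ kk1 ki.
  have [n Dn] : exists n, D u n.
    case: lx => lx; [exists (xi, c xi (e i), c xi (f C (map e u))), (e i), (f C (map e u))|
      exists (xi, c xi (f C (map e u)), c xi (e i)), (f C (map e u)), (e i)]; by split.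
  apply: (gP n); exists u; first by split=> //; exists i.
  apply: sub_all ku => j kj.
  by apply: wo_trans RKwo _ _ _ (k2P n) _; exact: wo_trans RKwo _ _ _ kk2 kj.
have [|//|xi1 [u [u' [[_ Du] [_ Du'] sg]]]] := IH (Y' n).
  by move=> u [[i /Yb[[su] /andP[_ pu]]] _].
move: Du Du' => [v0 [v1 [v0c v1c v01 ev0 ev1]]] [v0' [v1' [v0c' v1c' v01' ev0' ev1']]].
set xi := n.1.1 in v01 ev0 ev1 v01' ev0' ev1'.
have [xi2 [lexi lexi1]] : exists xi2, RL xi xi2 /\ RL xi1 xi2.
  by case/orP: (wo_total RLwo xi xi1) => ?; [exists xi1|exists xi]; rewrite wo_refl.
have ag x : agree xi x x by [].
(* Both fibres have a lower and an upper point with the same codes, so the lower point over one tail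
   lies below the upper point over the other. *)
have [x [y [xc yc xy]]] : exists x y, [/\ clos C (map e u) x, clos C (map e u') y &
    if s then lexat xi2 x y else lexat xi2 y x].
  case: s {IH Yb}; [exists v0, v1'|exists v1, v0']; split=> //; apply: lexat_mono lexi _.
    by apply: lexat_agree (ag _) _ v01; apply/cP; rewrite ev1.
  by apply: lexat_agree (ag _) _ v01'; apply/cP; rewrite ev1.
(* Members of Y with the same codes at [xi2] as these closure points inherit the comparisons. *)
have [b Y_b eb] := closP _ _ xc xi2; have [b' Y_b' eb'] := closP _ _ yc xi2.
exists xi2, b, b'; split=> //.
by apply: signs_code eb eb' _; split=> //; exact: signs_mono lexi1 sg.
Qed.

End Generic.
End Code.
End Levels.

(** * Large families of finite sets *)

Local Open Scope fset_scope.

Section Delta.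
Variables (K : choiceType) (RK : rel K).
Hypotheses (RKwo : well_order RK) (RKini : forall k, ~ embeds K [set y | RK y k]).
Hypotheses (RKcof : forall B, cofinal_set RK B -> embeds K B).
Hypotheses (leNK : embeds nat K) (nKN : ~ embeds K nat).

(** Were every class bounded in the enumeration by K, a common bound of these bounds would index an
    element of no class. *)
Lemma cf_pigeonhole T N (X : set T) (Xn : N -> set T) : ~ embeds K N -> embeds K X ->
  (forall x, X x -> exists n, Xn n x) -> exists n, embeds K (Xn n).
Proof.
move=> nN [g gI] XXn; pose B n : set K := [set k | Xn n (val (g k))].
have [[n Bn]|/forallNP nB] := pselect (exists n, cofinal_set RK (B n)).
  exists n; apply: embeds_trans (RKcof Bn) _.
  apply: (embeds_rel (G := fun b x => val (g (val b)) = val x)).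
    by move=> b; exists (set_elt (A := Xn n) (set_valP b)).
  by move=> b b' x eb eb'; apply/val_inj/gI/val_inj; rewrite eb eb'.
have /choice[h hP] n : exists k, forall b, B n b -> ~ RK k b.
  by have /existsNP[k nk] := nB n; exists k => b Bb kb; apply: nk; exists b.
have [k kP] := cf_bounded RKwo RKcof h nN.
by have [n gn] := XXn _ (set_valP (g k)); case: (hP n k gn).
Qed.

(** Weak Delta-system: members only have to leave every bound outside the root. If r fails at k,
    then kappa many members share a further point at or below k, which joins the root. *)
Lemma delta_root (X : set {fset K}) : embeds K X -> exists r : {fset K},
  forall k, exists x, [/\ X x, r `<=` x, x <> r & forall a, a \in x -> a \notin r -> RK k a].
Proof.
move=> leX.
have [n {leX}leX] : exists n, embeds K [set x | X x /\ #|` x| = n].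
  by apply: cf_pigeonhole nKN leX _ => x Xx; exists #|` x|.
(* Members have fewer than m points outside r, so the root can grow only finitely often. *)
suff h m r : embeds K [set x | [/\ X x, r `<=` x & #|` x| < m + #|` r|]] ->
    exists r : {fset K}, forall k, exists x,
    [/\ X x, r `<=` x, x <> r & forall a, a \in x -> a \notin r -> RK k a].
  apply: (h n.+1 fset0); apply: embeds_trans leX _; apply/card_leE/subset_card_le => x [Xx <-].
  by split; rewrite ?fsub0set // addSn ltnS leq_addr.
elim: m r => [|m IH] r leXr.
  have [g _] := embeds_trans leNK leXr.
  have [_ /fsubset_leq_card rx xr] := set_valP (g 0).
  by have := leq_trans xr rx; rewrite ltnn.
have [?|/existsNP[k /forallNP nk]] := pselect (forall k, exists x,
    [/\ X x, r `<=` x, x <> r & forall a, a \in x -> a \notin r -> RK k a]).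
  by exists r.
(* [None] stands for the case x = r, a singleton class that the pigeonhole cannot return. *)
pose Xn (o : option [set y | RK y k]) : set {fset K} := if o is Some a then
    [set x | [/\ X x, val a |` r `<=` x, val a \notin r & #|` x| < m.+1 + #|` r|]]
    else [set r].
have [|x [Xx rx sx]|[a|] le_n] := @cf_pigeonhole _ _ _ Xn _ leXr.
- by move=> /(embeds_option_inv leNK); exact: RKini.
- have [->|xr] := pselect (x = r); first by exists None.
  have /existsNP[a /not_implyP[ax /not_implyP[ar /negP aN]]] :
    ~ (forall a, a \in x -> a \notin r -> RK k a) by move=> h; apply: (nk x).
  exists (Some (set_elt (A := [set y | RK y k]) (woN RKwo aN))).
  by split=> //; rewrite fsubUset fsub1set ax.
- apply: (IH (val a |` r)); apply: embeds_trans le_n _.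
  apply/card_leE/subset_card_le => x [Xx ax ar sx]; split=> //.
  by rewrite cardfsU1 ar addnCA add1n -addSn.
- have [g gI] := embeds_trans leNK le_n.
  by have // : 0 = 1 by apply/gI/val_inj; rewrite (set_valP (g 0)) (set_valP (g 1)).
Qed.

End Delta.

(** * Tuples with a block of coordinates for each point of a finite set *)

Section Blocks.
Variables (L : Type) (RL : rel L) (K : choiceType) (RK : rel K).
Hypothesis (RKwo : well_order RK).
Variables (e : K * nat -> L -> bool) (t : nat -> bool) (ms : seq nat).

Definition blocks (s : seq K) : seq (K * nat) := [seq (a, m) | a <- s, m <- ms].

Definition block_signs n := flatten (nseq n (map t ms)).

Lemma size_blocks s : size (blocks s) = size (block_signs (size s)).
Proof. by rewrite size_allpairs; elim: s => //= a s IH; rewrite size_cat size_map -IH. Qed.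

Lemma blocks_pairwise s : pairwise (fun a b => ~~ RK a b) s ->
  pairwise (fun m n => n < m) ms -> pairwise (fun i j => ltI RK j i) (blocks s).
Proof.
move=> + pms; elim: s => //= a s IH /andP[/allP as_ /IH ps].
rewrite /blocks allpairs_cons pairwise_cat ps andbT; apply/andP; split.
  apply/allrelP => i j /mapP[m _ ->] /allpairsP[[b n] /= [/as_ ab _ ->]].
  by rewrite /ltI /= ab.
rewrite pairwise_map; apply: sub_pairwise pms => m n /= nm.
by rewrite /ltI /= eqxx nm orbT.
Qed.

Lemma signs_blocks xi s s' : size s = size s' ->
  signs RL xi (block_signs (size s)) (map e (blocks s)) (map e (blocks s')) ->
  forall p, p \in zip s s' -> forall m, m \in ms ->
  if t m then lexat RL xi (e (p.1, m)) (e (p.2, m)) else lexat RL xi (e (p.2, m)) (e (p.1, m)).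
Proof.
have h a b ns ts u v : signs RL xi (map t ns ++ ts)
    (map e (map (pair a) ns) ++ u) (map e (map (pair b) ns) ++ v) ->
    signs RL xi ts u v /\ forall m, m \in ns ->
    if t m then lexat RL xi (e (a, m)) (e (b, m)) else lexat RL xi (e (b, m)) (e (a, m)).
  elim: ns => //= n ns IH [hn /IH[? hs]]; split=> // m.
  by rewrite inE => /orP[/eqP->//|/hs].
elim: s s' => [|a s IH] [|b s'] // [ss]; rewrite /blocks !allpairs_cons !map_cat.
move=> /h[/(IH _ ss) {}IH hm] p; rewrite inE => /orP[/eqP->|/IH] //.
Qed.

End Blocks.

Lemma mem_zip_map (T : eqType) U (g : T -> U) s s' : map g s = map g s' ->
  forall p, p \in zip s s' -> g p.1 = g p.2 /\ p.2 \in s'.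
Proof.
elim: s s' => [|a s IH] [|b s'] //= [ab /IH{}IH] p.
rewrite !inE => /orP[/eqP->|/IH[-> ->]]; first by rewrite eqxx.
by rewrite orbT.
Qed.

Lemma mem_zip_l (T : eqType) (s s' : seq T) a : size s = size s' -> a \in s ->
  exists b, (a, b) \in zip s s'.
Proof.
elim: s s' => [|x s IH] [|y s'] //= [/IH{}IH]; rewrite inE => /orP[/eqP->|/IH[b bs]].
  by exists y; rewrite inE eqxx.
by exists b; rewrite inE bs orbT.
Qed.

(** * The colouring *)

Section Colouring.
Variables (L : Type) (RL : rel L) (K : choiceType) (e : K * nat -> L -> bool).
Hypothesis RLwo : well_order RL.

Definition lexlt (x y : L -> bool) := exists xi, lexat RL xi x y.

Definition pair_colour n (a b : K) :=
  (forall m, m <= n -> lexlt (e (a, m)) (e (b, m))) /\ lexlt (e (b, n.+1)) (e (a, n.+1)).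

Definition fset_colour n (z : {fset K}) := exists xi,
  (exists a b, [/\ a \in z, b \in z, a <> b & agree RL xi (e (a, 0)) (e (b, 0))]) /\
  forall a b, a \in z -> b \in z -> a <> b -> agree RL xi (e (a, 0)) (e (b, 0)) ->
    pair_colour n a b \/ pair_colour n b a.

Lemma lexlt_asym x y : lexlt x y -> lexlt y x -> False.
Proof. by move=> [xi h] [xi' h']; exact: (lex_asym RLwo h h'). Qed.

(** Coordinate 0 fixes the orientation, and n + 1 is the first coordinate where the comparison
    flips. *)
Lemma pair_colour_inj n n' a b : pair_colour n a b \/ pair_colour n b a ->
  pair_colour n' a b \/ pair_colour n' b a -> n = n'.
Proof.
have same a' b' k k' : pair_colour k a' b' -> pair_colour k' a' b' -> k = k'.
  move=> [h1 h2] [h1' h2']; case: (ltngtP k k') => // kk; exfalso.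
    exact: lexlt_asym (h1' _ kk) h2.
  exact: lexlt_asym (h1 _ kk) h2'.
have anti a' b' k k' : pair_colour k a' b' -> pair_colour k' b' a' -> k = k'.
  by move=> [h _] [h' _]; case: (lexlt_asym (h 0 (leq0n _)) (h' 0 (leq0n _))).
by move=> [h|h] [h'|h']; [exact: same h h'|exact: anti h h'|exact: anti h h'|exact: same h h'].
Qed.

Lemma agree_mono xi xi' x y : RL xi xi' -> agree RL xi' x y -> agree RL xi x y.
Proof. by move=> xx h l lxi; apply: h; exact: wo_trans RLwo _ _ _ lxi xx. Qed.

(** A pair agreeing up to the higher of the two levels is coloured by both witnesses. *)
Lemma fset_colour_inj n n' z : fset_colour n z -> fset_colour n' z -> n = n'.
Proof.
move=> [xi [[a [b [az bz ab abxi]]] h]] [xi' [[a' [b' [az' bz' ab' abxi']]] h']].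
case/orP: (wo_total RLwo xi xi') => xx.
  have ag := agree_mono xx abxi'.
  exact: pair_colour_inj (h _ _ az' bz' ab' ag) (h' _ _ az' bz' ab' abxi').
have ag := agree_mono xx abxi.
exact: pair_colour_inj (h _ _ az bz ab abxi) (h' _ _ az bz ab ag).
Qed.

Lemma fset_separation (z : {fset K}) : L -> (forall a b, a <> b -> e (a, 0) <> e (b, 0)) ->
  exists xi, forall a b, a \in z -> b \in z -> agree RL xi (e (a, 0)) (e (b, 0)) -> a = b.
Proof.
move=> l0 eI; have [xi h] : exists xi, forall p, p \in [seq (a, b) | a <- z, b <- z] ->
    agree RL xi (e (p.1, 0)) (e (p.2, 0)) -> p.1 = p.2.
  elim: [seq _ | _ <- _, _ <- _] => [|[a b] s [xi IH]]; first by exists l0.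
  have [l hl] : exists l, agree RL l (e (a, 0)) (e (b, 0)) -> a = b.
    have [->|/eI ab] := pselect (a = b); first by exists l0.
    have /existsNP[l hl] : ~ forall l, e (a, 0) l = e (b, 0) l.
      by move=> h; apply: ab; apply/funext.
    by exists l => /(_ l (wo_refl RLwo l)).
  have [m [xim lm]] : exists m, RL xi m /\ RL l m.
    by case/orP: (wo_total RLwo xi l) => ?; [exists l|exists xi]; rewrite wo_refl.
  exists m => p; rewrite inE => /orP[/eqP-> /(agree_mono lm)//|ps /(agree_mono xim)].
  exact: IH.
by exists xi => a b az bz; apply: (h (a, b)); apply/allpairsP; exists (a, b).
Qed.

End Colouring.

Theorem theorem3p8 (L : Type) (K : choiceType)
    (L_infinite : infinite_set [set: L]%classic)
    (pow2_lt_L : is_pow2_lt L L)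
    (K_cf : is_cf (L -> bool) K) :
  circledast K nat.
Proof.
have leNL : embeds nat L by move: L_infinite => /infiniteP/card_le_setT.
have [l0] : exists l : L, True by have [n _] := leNL; exists (n 0).
move=> _; have nKL := konig leNL K_cf.
have [RK [RKwo RKini RKcof leKP [F [FP Fsmall]]]] := cf_regular leNL K_cf.
have leLK : embeds L K by case: (embeds_total K L).
have leNK := embeds_trans leNL leLK.
have nKN : ~ embeds K nat by move=> h; apply: nKL; exact: embeds_trans h leNL.
have [k0 _] : exists k : K, True by have [n _] := leNK; exists (n 0).
have [RL [RLwo RLini]] := initial_exists L.
have {}RLini := seg_le RLwo leNL RLini.
have [c cP] := level_code pow2_lt_L RLini.
have [f fP] := clos_select c.
have [w wI] : embeds (seq L -> bool) (L -> bool) by exact: embeds_fun (embeds_seq leNL).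
have [e [eI eP]] := generic_family RKwo leNL RKini leKP Fsmall f wI.
have {}eI a b : a <> b -> e (a, 0) <> e (b, 0).
  move=> ab; case: (boolP (RK a b)) => [|] h.
    apply/nesym/eI; rewrite /ltI /=; apply/orP; left; apply/negP => h'.
    exact: ab (wo_anti RKwo h h').
  by apply: eI; rewrite /ltI /= h.
(* Finite sets without a colour get 0. *)
have [d dP] : exists d : {fset K} -> nat, forall z n, fset_colour RL e n z -> d z = n.
  have /choice[d dP] (z : {fset K}) : exists m, forall n, fset_colour RL e n z -> m = n.
    have [[m hm]|nm] := pselect (exists m, fset_colour RL e m z).
      by exists m => n hn; exact: fset_colour_inj hm hn.
    by exists 0 => n hn; case: nm; exists n.
  by exists d.
exists d => X Xcard delta.
have leKX : embeds K X.
  by move: Xcard; rewrite card_eq_le => /andP[_ /card_leE]; apply: embeds_trans (embeds_setT K).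
have [r rP] := delta_root RKwo RKini RKcof leNK nKN leKX.
(* Coordinates are listed downwards because [entangled] wants decreasing tuples; [t] flips the
   comparison at delta + 1 only. *)
pose ms := rev (iota 0 delta.+2); pose t m := m <= delta.
have pms : pairwise (fun m n => n < m) ms.
  rewrite -sorted_pairwise; last by move=> x y z yx zx; exact: ltn_trans zx yx.
  by rewrite rev_sorted iota_ltn_sorted.
have inms m : (m \in ms) = (m < delta.+2) by rewrite mem_rev mem_iota.
pose root_data s (x : {fset K}) := [/\ X x, r `<=` x, x <> r,
  pairwise (fun a b => ~~ RK a b) s & forall a, (a \in s) = (a \in x) && (a \notin r)].
(* Members sharing v have the same separating level and the same codes there, so corresponding
   points agree up to that level. *)
pose data (v : seq L) s (x : {fset K}) := exists xi, [/\ root_data s x,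
  v = xi :: map (fun a => c xi (e (a, 0))) s &
  forall a b, a \in x -> b \in x -> agree RL xi (e (a, 0)) (e (b, 0)) -> a = b].
pose Y (v : seq L) := [set b | exists s x, data v s x /\ b = blocks ms s].
(* There are at most lambda many v, fewer than kappa, so one of them occurs beyond every bound. *)
have [v vP] : exists v, forall k, exists2 b, Y v b & all (fun i => RK k i.1) b.
  apply: contrapT => /forallNP h.
  have /choice[g gP] v : exists k, ~ exists2 b, Y v b & all (fun i => RK k i.1) b.
    by apply/existsNP; exact: h.
  have [|k kP] := cf_bounded RKwo RKcof g.
    by move=> h'; apply: nKL; exact: embeds_trans h' (embeds_seq leNL).
  have [x [Xx rx xr xk]] := rP k.
  have [xi sep] := fset_separation RLwo x l0 eI.
  pose s := sort (fun a b => RK b a) [seq a <- x | a \notin r].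
  have sE a : (a \in s) = (a \in x) && (a \notin r) by rewrite mem_sort mem_filter andbC.
  have s_desc : pairwise (fun a b => ~~ RK a b) s.
    have us : uniq s by rewrite sort_uniq filter_uniq.
    have : pairwise (fun a b => RK b a) s.
      rewrite -sorted_pairwise; last by move=> a b a' h1 h2; exact: wo_trans RKwo _ _ _ h2 h1.
      by apply: sort_sorted => a b; exact: wo_total.
    move: us; rewrite uniq_pairwise => us ps.
    have := conj us ps => /andP; rewrite -pairwise_relI; apply: sub_pairwise => a b /=.
    by move=> /andP[/eqP ab ba]; apply/negP => h'; exact: ab (wo_anti RKwo h' ba).
  apply: (gP (xi :: map (fun a => c xi (e (a, 0))) s)).
  exists (blocks ms s); first by exists s, x; split=> //; exists xi.
  apply/allP => i /allpairsP[[a m] /= [sa _ ->]] /=.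
  by apply: wo_trans RKwo _ _ _ (kP _) _; move: sa; rewrite sE => /andP[]; exact: xk.
(* The predecessor of [size v] discounts the level at its head. *)
have [|xi0 [_ [_ [[s [x [[xi [[Xx rx xr _ sE] vE sep]] ->]]]
    [s' [x' [[xi' [[Xx' rx' _ _ sE'] vE' sep']] ->]]] sg]]]] :=
    @entangled _ _ RLwo _ cP _ _ RKwo leNL RKcof nKL F FP w f e k0 fP eP
    (block_signs t ms (size v).-1) (Y v) _ vP.
  move=> b [s [x [[xi [[_ _ _ sd _] -> _]] ->]]]; split; last exact: blocks_pairwise.
  by rewrite (size_blocks t) /= size_map.
move: sg vE'; rewrite vE /= size_map => sg [xiE]; rewrite -{}xiE in sep' * => codes {vE}.
have ss : size s = size s' by have := congr1 size codes; rewrite !size_map.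
have col a b : (a, b) \in zip s s' -> pair_colour RL e delta a b.
  move=> ab; have lx := signs_blocks ss sg ab; split.
    move=> m md; have := lx m; rewrite inms /t md /= => h; exists xi0; apply: h.
    by rewrite ltnS (leq_trans md).
  by have := lx delta.+1; rewrite inms /t ltnn ltnS leqnn => /(_ isT) h; exists xi0.
have zipag a b : (a, b) \in zip s s' -> agree RL xi (e (a, 0)) (e (b, 0)) /\ b \in s'.
  by move=> /(mem_zip_map codes)[/= /cP].
have agT := fun a b c' (h : agree RL xi a b) (h' : agree RL xi b c') =>
  (fun l lxi => etrans (h l lxi) (h' l lxi)) : agree RL xi a c'.
have agS a b : agree RL xi a b -> agree RL xi b a by move=> h l lxi; rewrite h.
(* Since xi separates [x'], b must be the point corresponding to a. *)
have cross a b : a \in s -> b \in x' -> agree RL xi (e (a, 0)) (e (b, 0)) ->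
    pair_colour RL e delta a b.
  move=> sa xb ab; have [b' zb] := mem_zip_l ss sa; have [ab' sb'] := zipag _ _ zb.
  have -> : b = b'; last exact: col.
  apply: sep' => //; first by move: sb'; rewrite sE' => /andP[].
  exact: agT (agS _ _ ab) ab'.
have [a sa] : exists a, a \in s.
  apply: contrapT => /forallNP ns; apply: xr; apply/eqP; rewrite eqEfsubset rx andbT.
  apply/fsubsetP => a ax; apply: contrapT => /negP ar.
  by apply: (ns a); rewrite sE ax.
have [b zab] := mem_zip_l ss sa; have [abxi sb] := zipag _ _ zab.
have [ax ar] : a \in x /\ a \notin r by apply/andP; rewrite -sE.
have [bx' br] : b \in x' /\ b \notin r by apply/andP; rewrite -sE'.
have ab : a <> b.
  move=> ab; have [h _] := col _ _ zab; have h0 := h 0 isT; rewrite -ab in h0.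
  exact: (lexlt_asym RLwo h0 h0).
(* The points a and b agree up to xi, so they cannot lie in the same member. *)
have ax' : a \notin x' by apply/negP => ax'; apply: ab; exact: sep'.
have bx : b \notin x by apply/negP => bx; apply: ab; exact: sep.
exists x, x'; split=> //; first by move=> xx; rewrite -xx ax in ax'.
move=> z /fsubsetP dz /fsubsetP zU; apply: dP; exists xi; split.
  by exists a, b; split=> //; apply: dz; rewrite !inE ?ax ?ax' ?bx ?bx'.
have mem_s a' : a' \in x -> a' \notin x' -> a' \in s.
  by move=> h1 h2; rewrite sE h1; apply: contra h2; exact: (fsubsetP rx').
move=> a1 b1 /zU + /zU + ab1 ag1; rewrite !inE.
(* Separation excludes two points of [x'] or two of x, which leaves one point of x outside [x'] and
   one of [x']. *)
have [b1x'|b1x'] := boolP (b1 \in x'); have [a1x'|a1x'] := boolP (a1 \in x').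
- by case: ab1; exact: sep'.
- by rewrite orbF => a1x _; left; apply: cross => //; exact: mem_s.
- by rewrite orbF => _ b1x; right; apply: cross => //; [exact: mem_s|exact: agS].
- by rewrite !orbF => a1x b1x; case: ab1; exact: sep.
Qed.
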